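(* Let $\Gamma$ be a finite, simple, connected, undirected, regular graph with adjacency matrix $A$ and exactly $d+1$ distinct eigenvalues. Then $\mathcal{A}=\operatorname{span}\{I,A,\ldots,A^d\}$ is closed under Hadamard multiplication if and only if $\Gamma$ is a quotient-polynomial graph.
   Context: For vertices $y,z$ let $\mathbf{w}(y,z)=((A^0)_{yz},(A^1)_{yz},\ldots,(A^d)_{yz})^\top$. The walk-regular partition of $X\times X$ ($X$ the vertex set) is the partition $\{R_0,\ldots,R_r\}$ where $(y,z),(u,v)$ lie in the same class iff $\mathbf{w}(y,z)=\mathbf{w}(u,v)$; $M_i$ denotes the $(0,1)$ adjacency matrix of $R_i$. $\Gamma$ is quotient-polynomial if $M_i\in\mathcal{A}$ for all $i$. Hadamard multiplication is entrywise multiplication. *)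

(* Defs.v *)
From HB Require Import structures.
From mathcomp Require Import all_boot all_order all_algebra.

Set Implicit Arguments.
Unset Strict Implicit.
Unset Printing Implicit Defensive.

Import GRing.Theory.
Local Open Scope ring_scope.

Section Graph.

Variables (T : finType) (e : rel T).

Definition simple_graph : Prop := symmetric e /\ irreflexive e.

Definition connected_graph : Prop := forall x y : T, connect e x y.

Definition regular_graph : Prop :=
  exists k : nat, forall x : T, #|[set y | e x y]| = k.

End Graph.

(* Matrices indexed by the vertex set T are elements of 'M_#|T|, the vertex x
   being the index enum_rank x. *)
Section AdjacencyAlgebra.

Variables (F : fieldType) (T : finType) (e : rel T).

Definition rel_mx (P : {set T * T}) : 'M[F]_#|T| :=
  \matrix_(i, j) ((enum_val i, enum_val j) \in P)%:R.

Definition adj_mx : 'M[F]_#|T| := rel_mx [set p | e p.1 p.2].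

Definition adj_span (d : nat) : {vspace 'M[F]_#|T|} :=
  <<[seq adj_mx ^+ i | i <- iota 0 d.+1]>>%VS.

Definition walk_vector (d : nat) (p : T * T) : 'cV[F]_d.+1 :=
  \col_(i < d.+1) (adj_mx ^+ i) (enum_rank p.1) (enum_rank p.2).

Definition walk_regular_partition (d : nat) : {set {set T * T}} :=
  preim_partition (walk_vector d) [set: T * T].

Definition quotient_polynomial (d : nat) : Prop :=
  forall P : {set T * T}, P \in walk_regular_partition d ->
    rel_mx P \in adj_span d.

End AdjacencyAlgebra.

Definition hadamard_mx (F : fieldType) (n : nat) (B C : 'M[F]_n) : 'M[F]_n :=
  map2_mx *%R B C.

Definition hadamard_closed (F : fieldType) (n : nat) (V : {vspace 'M[F]_n}) :
    Prop :=
  forall B C : 'M[F]_n, B \in V -> C \in V -> hadamard_mx B C \in V.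

Definition num_distinct_eigenvalues (F : fieldType) (n : nat) (B : 'M[F]_n)
    (m : nat) : Prop :=
  exists s : seq F,
    [/\ uniq s, size s = m & forall a : F, (a \in s) = eigenvalue B a].

(* Main.v *)
Require Import Defs.
From mathcomp Require Import all_boot all_order all_algebra.
From mathcomp Require Import complex.

(** Write [w] for the walk vector. Every element of the span is constant on the
    classes of [w], so if the class indicators lie in the span, then the span
    consists of all matrices constant on the classes, which are closed under
    entrywise products. Conversely, a Hadamard closed span separates the classes
    and contains, by interpolation, the indicator of every class on which [w]
    does not vanish. No class has [w = 0]: the adjacency matrix is symmetric,
    hence diagonalizable with real eigenvalues, so all its powers lie in the
    span of the first [d.+1] ones, and by connectedness some power is nonzero at
    any given pair of vertices. *)

Set Implicit Arguments.
Unset Strict Implicit.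
Unset Printing Implicit Defensive.

Import Order.TTheory GRing.Theory Num.Theory.
Local Open Scope ring_scope.

(** * Powers of a real symmetric matrix *)

Section SymmetricMatrix.

Variable R : rcfType.

(** Over the complexification [A] is Hermitian, hence unitarily diagonalizable with real diagonal
    entries. These are eigenvalues of [A], so the product vanishes on the diagonal form. *)
Lemma horner_mx_sym_eq0 (n : nat) (A : 'M[R]_n.+1) (s : seq R) :
  A^T = A -> (forall a, eigenvalue A a -> a \in s) ->
  horner_mx A (\prod_(a <- s) ('X - a%:P)) = 0.
Proof.
move=> symA eigA; set p := \prod_(a <- s) _.
pose iota := real_complex R; pose AC := map_mx iota A.
have hermAC : AC \is hermsymmx.
  apply/is_hermitianmxP; rewrite expr0 scale1r; apply/matrixP=> i j.
  by rewrite !mxE -[in LHS]symA mxE; apply/esym/conjc_real.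
have realsp := hermitian_spectral_diag_real hermAC.
have /orthomx_spectralP := hermitian_normalmx hermAC.
set P := spectralmx AC; set sp := spectral_diag AC in realsp * => ACE.
have Punit : P \in unitmx by exact: spectral_unit.
apply: (map_mx_inj (f := iota)); rewrite map_horner_mx map_mx0 -/AC ACE.
rewrite horner_mx_uconjC // horner_mx_diag.
suff -> : map_mx (horner (map_poly iota p)) sp = 0.
  by rewrite linear0 mulmx0 mul0mx.
apply/matrixP=> i j; rewrite ord1 !mxE {i}.
have /complex_realP[x Esp] := mxOverP realsp 0 j.
rewrite Esp horner_map.
suff xs : x \in s.
  by have /eqP-> : root p x; rewrite ?root_prod_XsubC ?rmorph0.
(* Eigenvalues pass between [A] and [AC] through the characteristic polynomial; row [j] of [P] is a
   left eigenvector of [AC] for the [j]-th diagonal entry. *)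
apply: eigA; rewrite eigenvalue_root_char -(fmorph_root iota) map_char_poly.
rewrite -eigenvalue_root_char; apply/eigenvalueP; exists (row j P).
  rewrite -/AC ACE !mulmxA -!row_mul mulmxV // mul1mx.
  by rewrite row_mul row_diag_mx Esp -scalemxAl -rowE.
apply/eqP=> Pj0; have := congr1 (row j) (mulmxV Punit).
rewrite row_mul Pj0 mul0mx => /rowP/(_ j); rewrite !mxE eqxx => /esym/eqP.
by rewrite oner_eq0.
Qed.

(** Reduce ['X^k] modulo the annihilating polynomial of degree [m]; the remainder supplies the
    coefficients. *)
Lemma sym_expr_lincomb (n m : nat) (A : 'M[R]_n) :
  A^T = A -> num_distinct_eigenvalues A m ->
  forall k, exists c : 'I_m -> R, A ^+ k = \sum_(i < m) c i *: A ^+ i.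
Proof.
case: n A => [|n] A symA [s [_ sz_s eigA]] k.
  by exists (fun=> 0); apply/matrixP=> -[].
pose p := \prod_(a <- s) ('X - a%:P).
have pA0 : horner_mx A p = 0 by apply: horner_mx_sym_eq0 => // a; rewrite eigA.
have mon_p : p \is monic by apply: monic_prod_XsubC.
pose q := 'X^k %% p; exists (fun i => q`_i).
have sz_q : (size q <= m)%N.
  by rewrite -ltnS -sz_s -(size_prod_XsubC s id) ltn_modp monic_neq0.
have -> : A ^+ k = horner_mx A q.
  rewrite -[in LHS](horner_mx_X A) -rmorphXn [in LHS](divp_eq 'X^k p) /=.
  by rewrite rmorphD rmorphM /= pA0 mulr0 add0r.
have -> : q = \poly_(i < m) q`_i.
  apply/polyP=> i; rewrite coef_poly; case: ltnP => // le_m_i.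
  by rewrite nth_default // (leq_trans sz_q).
rewrite poly_def linear_sum; apply: eq_bigr => i _.
by rewrite linearZ /= rmorphXn /= horner_mx_X -poly_def coef_poly ltn_ord.
Qed.

End SymmetricMatrix.

(** * Positivity of walk counts *)

Section AdjacencyMatrix.

Variables (R : numFieldType) (T : finType) (e : rel T).

Local Notation A := (adj_mx R e).

Lemma adj_mx_sym : symmetric e -> A^T = A.
Proof. by move=> sym_e; apply/matrixP=> i j; rewrite !mxE !inE /= sym_e. Qed.

Lemma adj_mxX_ge0 (k : nat) (i j : 'I_#|T|) : 0 <= (A ^+ k) i j.
Proof.
elim: k i j => [|k IHk] i j; first by rewrite mxE ler0n.
by rewrite exprS mxE sumr_ge0 // => l _; rewrite mulr_ge0 // !mxE ler0n.
Qed.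

Lemma adj_mxX_path (x : T) (p : seq T) : path e x p ->
  0 < (A ^+ size p) (enum_rank x) (enum_rank (last x p)).
Proof.
elim: p x => [|y p IHp] x /=; first by rewrite mxE eqxx ltr01.
(* The summand through [y] is positive, and the nonnegative others cannot cancel it. *)
case/andP=> exy /IHp Ap_gt0; rewrite exprS mxE (bigD1 (enum_rank y)) //=.
rewrite ltr_wpDr //; last by rewrite !mxE !inE !enum_rankK exy mul1r.
by apply: sumr_ge0 => l _; rewrite mulr_ge0 ?adj_mxX_ge0 // !mxE ler0n.
Qed.

End AdjacencyMatrix.

(** * Interpolation on the walk-regular classes *)

Section WalkClasses.

Variables (R : fieldType) (T : finType) (e : rel T) (d : nat).

Local Notation A := (adj_mx R e).
Local Notation V := (adj_span R e d).
Local Notation w := (walk_vector R e d).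

Definition mx_entry (B : 'M[R]_#|T|) (p : T * T) : R :=
  B (enum_rank p.1) (enum_rank p.2).

Definition walk_constant (B : 'M[R]_#|T|) : Prop :=
  forall p q, w p = w q -> mx_entry B p = mx_entry B q.

Lemma mx_entryP (B C : 'M[R]_#|T|) : mx_entry B =1 mx_entry C -> B = C.
Proof.
move=> eqBC; apply/matrixP=> i j.
by have := eqBC (enum_val i, enum_val j); rewrite /mx_entry /= !enum_valK.
Qed.

Lemma mx_entry_rel_mx (P : {set T * T}) (p : T * T) :
  mx_entry (rel_mx R P) p = (p \in P)%:R.
Proof. by rewrite /mx_entry mxE !enum_rankK; case: p. Qed.

Lemma walk_vectorE (p : T * T) (i : 'I_d.+1) : w p i 0 = mx_entry (A ^+ i) p.
Proof. by rewrite mxE. Qed.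

Lemma adj_span_expr (i : 'I_d.+1) : A ^+ i \in V.
Proof. by apply/memv_span/map_f; rewrite mem_iota /=. Qed.

Lemma adj_span_lincomb (B : 'M[R]_#|T|) : B \in V ->
  exists c : 'I_d.+1 -> R, B = \sum_(i < d.+1) c i *: A ^+ i.
Proof.
pose X := [tuple A ^+ (i : 'I_d.+1) | i < d.+1].
have -> : V = <<X>>%VS.
  by rewrite /adj_span -val_enum_ord -map_comp; congr span.
move/coord_span=> ->; exists (fun i => coord X i B).
by apply: eq_bigr => i _; rewrite -tnth_nth tnth_mktuple.
Qed.

Lemma adj_span_walk_constant (B : 'M[R]_#|T|) : B \in V -> walk_constant B.
Proof.
case/adj_span_lincomb=> c -> p q eq_w; rewrite /mx_entry !summxE.
apply: eq_bigr => i _; rewrite !mxE; congr (_ * _).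
by have := congr1 (fun v : 'cV_d.+1 => v i 0) eq_w; rewrite !walk_vectorE.
Qed.

Lemma walk_regular_partitionP (P : {set T * T}) :
  reflect (exists p, P = [set q | w p == w q])
          (P \in walk_regular_partition R e d).
Proof.
have classE p : [set q in [set: T * T] | w p == w q] = [set q | w p == w q].
  by apply/setP=> q; rewrite !inE.
by apply: (iffP imsetP) => [[p _ ->] | [p ->]]; exists p; rewrite ?classE.
Qed.

(** The coefficient of a class is the value of [B] at any representative. Classes are nonempty, so
    the default 0 never occurs. *)
Lemma walk_constant_decomp (B : 'M[R]_#|T|) : walk_constant B ->
  B = \sum_(P in walk_regular_partition R e d)
        (if [pick p in P] is Some p then mx_entry B p else 0) *: rel_mx R P.
Proof.
move=> cB; apply: mx_entryP => p; rewrite [RHS]summxE.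
pose P0 := [set q | w p == w q].
have pP0 : p \in P0 by rewrite inE.
rewrite (bigD1 P0) /=; last by apply/walk_regular_partitionP; exists p.
rewrite [X in _ + X]big1 => [|P /andP[/walk_regular_partitionP[q ->] neqP]].
  rewrite addr0 mxE -[rel_mx R P0 _ _]/(mx_entry _ p) mx_entry_rel_mx pP0 mulr1.
  case: pickP => [q | /(_ p)]; last by rewrite pP0.
  by rewrite inE => /eqP/cB.
rewrite mxE -[rel_mx R _ _ _]/(mx_entry _ p) mx_entry_rel_mx inE.
case: eqP => [eq_w|]; last by rewrite mulr0.
by case/eqP: neqP; apply/setP=> r; rewrite !inE eq_w.
Qed.

Lemma quotient_polynomial_hadamard_closed :
  quotient_polynomial R e d -> hadamard_closed V.
Proof.
move=> qpV B C /adj_span_walk_constant cB /adj_span_walk_constant cC.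
have cBC : walk_constant (hadamard_mx B C).
  by move=> p q eq_w; rewrite /mx_entry !mxE; congr (_ * _); [apply: cB|apply: cC].
rewrite (walk_constant_decomp cBC); apply: memv_suml => P /qpV VP.
exact: memvZ.
Qed.

(** Lagrange interpolation, one factor for each [q] in [s] outside the class of [p]; the starting
    matrix is a power of [A] nonzero at [p], rescaled. *)
Lemma hadamard_closed_separate (p : T * T) (s : seq (T * T)) :
  hadamard_closed V -> w p != 0 ->
  exists B, [/\ B \in V, mx_entry B p = 1 &
                {in s, forall q, w p != w q -> mx_entry B q = 0}].
Proof.
move=> hcV wp_neq0; elim: s => [|q s [B [VB Bp Bs]]].
  have [i wpi] : exists i, w p i 0 != 0.
    by case/cV0Pn: wp_neq0 => i; exists i.
  exists ((w p i 0)^-1 *: A ^+ i); split=> //.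
    by rewrite memvZ ?adj_span_expr.
  by rewrite /mx_entry mxE -/(mx_entry _ _) -walk_vectorE mulVf.
have [eq_w | neq_w] := eqVneq (w p) (w q).
  exists B; split=> // r; rewrite inE => /predU1P[-> | /Bs //].
  by rewrite eq_w eqxx.
have [i neq_wi] : exists i, w p i 0 != w q i 0.
  have : w p - w q != 0 by rewrite subr_eq0.
  by case/cV0Pn=> i; rewrite !mxE subr_eq0 => ?; exists i; rewrite !mxE.
(* [C] is the entrywise product of [B] with [A ^+ i] shifted by [c], so it vanishes at [q] but not
   at [p]; in this expanded form its membership in [V] is visible. *)
pose c := w q i 0; pose C := hadamard_mx B (A ^+ i) - c *: B.
have CE r : mx_entry C r = mx_entry B r * (w r i 0 - c).
  by rewrite walk_vectorE /mx_entry !mxE mulrBr [c * _]mulrC.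
exists ((w p i 0 - c)^-1 *: C); split.
- by rewrite memvZ // memvB ?memvZ // hcV ?adj_span_expr.
- by rewrite /mx_entry mxE -/(mx_entry _ _) CE Bp mul1r mulVf // subr_eq0.
move=> r; rewrite inE /mx_entry mxE -/(mx_entry _ _) CE.
case/predU1P=> [-> _ | /Bs Br /Br ->]; first by rewrite subrr !mulr0.
by rewrite mul0r mulr0.
Qed.

Lemma hadamard_closed_quotient_polynomial :
  (forall p, w p != 0) -> hadamard_closed V -> quotient_polynomial R e d.
Proof.
move=> w_neq0 hcV P /walk_regular_partitionP[p ->].
(* [B] vanishes off the class of [p]; on that class it is constant, like every element of [V], with
   value 1. *)
have [B [VB Bp Bq]] := hadamard_closed_separate (enum {: T * T}) hcV (w_neq0 p).
suff <- : B = rel_mx R [set q | w p == w q] by [].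
apply: mx_entryP => q; rewrite mx_entry_rel_mx inE.
have [eq_w | neq_w] := eqVneq (w p) (w q).
  by rewrite -(adj_span_walk_constant VB eq_w) Bp.
by rewrite Bq ?mem_enum.
Qed.

End WalkClasses.

(** A path joining the two vertices may be longer than [d], but the corresponding power of [A] is a
    combination of those recorded in the walk vector, so they cannot all vanish at [p]. *)
Lemma connected_walk_vector_neq0 (R : rcfType) (T : finType) (e : rel T)
    (d : nat) (p : T * T) :
  symmetric e -> connected_graph e ->
  num_distinct_eigenvalues (adj_mx R e) d.+1 -> walk_vector R e d p != 0.
Proof.
move=> sym_e con_e spec_e; apply/eqP=> wp0.
have /connectP[s e_s last_s] := con_e p.1 p.2.
have := adj_mxX_path R e_s; rewrite -last_s.
have [c ->] := sym_expr_lincomb (adj_mx_sym R sym_e) spec_e (size s).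
rewrite summxE big1 ?ltxx // => i _; rewrite mxE.
by rewrite -/(mx_entry (adj_mx R e ^+ i) p) -walk_vectorE wp0 mxE mulr0.
Qed.

Theorem theorem1p5 (R : rcfType) (T : finType) (e : rel T) (d : nat)
  (e_simple : simple_graph e) (e_connected : connected_graph e)
  (e_regular : regular_graph e)
  (e_spectrum : num_distinct_eigenvalues (adj_mx R e) d.+1) :
  hadamard_closed (adj_span R e d) <-> quotient_polynomial R e d.
Proof.
case: e_simple => sym_e _; split.
  apply: hadamard_closed_quotient_polynomial => p.
  exact: connected_walk_vector_neq0.
exact: quotient_polynomial_hadamard_closed.
Qed.
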